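(* Let $n\ge 1$, let $\mathbb{G}^n$ be the step two nilpotent Lie group with elements $g=(t_1,\ldots,t_n;p;q_1,\ldots,q_n)\in\mathbb{R}^{2n+1}$ described in the context, and let $R_2(\mathbb{R})$ be the space of square integrable $\mathbb{C}^n$-valued functions $f=(f_1,\ldots,f_n)$ on $\mathbb{R}$ whose $j$-th component takes values in $\mathrm{span}_{\mathbb{R}}\{1,e_j\}\subset \mathcal{C}\ell(n)$. For $g=(t_1,\ldots,t_n;p;q_1,\ldots,q_n)\in\mathbb{G}^n$ and $f\in R_2(\mathbb{R})$ define $$[\rho_g f](x)=\left(e^{e_1(2t_1+q_1(\sqrt{2}x-p))}f_1(x-\sqrt{2}p),\ \ldots,\ e^{e_n(2t_n+q_n(\sqrt{2}x-p))}f_n(x-\sqrt{2}p)\right).$$ Then $\rho$ is a representation of $\mathbb{G}^n$ on $R_2(\mathbb{R})$, i.e. $\rho_g\rho_{g'}=\rho_{g*g'}$ for all $g,g'\in\mathbb{G}^n$, and it is unitary with respect to the Clifford algebra valued inner product $\langle\cdot,\cdot\rangle$ on $R_2(\mathbb{R})$: $$\langle \rho_g f,\rho_g f'\rangle=\langle f,f'\rangle\quad\text{for all } g\in\mathbb{G}^n,\ f,f'\in R_2(\mathbb{R}).$$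
   Context: $\mathcal{C}\ell(n)$ is the real Clifford algebra generated by $1,e_1,\ldots,e_n$ with $e_ie_j+e_je_i=-2\delta_{ij}$ for $1\le i,j\le n$. In particular $e_j^2=-1$, so $\mathrm{span}_{\mathbb{R}}\{1,e_j\}$ is a copy of $\mathbb{C}$ inside $\mathcal{C}\ell(n)$, and $e^{e_j\theta}=\cos\theta+e_j\sin\theta$ for $\theta\in\mathbb{R}$. Here $\mathbb{C}^n$ means the space of $n$-tuples $u=(u_1,\ldots,u_n)$ with $u_j=u_j'+u_j''e_j$ and $u_j',u_j''\in\mathbb{R}$ (the $j$-th component is spanned over $\mathbb{R}$ by $1$ and $e_j$). Write $\bar u_j=u_j'-u_j''e_j$. The Clifford valued product of two such vectors is $u\cdot v=\sum_{j=1}^n\bar u_jv_j\in\mathcal{C}\ell(n)$. $R_2(\mathbb{R})$ is the space of square integrable ($L_2$) functions $f:\mathbb{R}\to\mathbb{C}^n$ in this sense, with the Clifford valued inner product $\langle f,f'\rangle=\int_{\mathbb{R}}f(x)\cdot f'(x)\,dx$. The group $\mathbb{G}^n$ is $\mathbb{R}^{2n+1}$ with elements $(t_1,\ldots,t_n;p;q_1,\ldots,q_n)$ and group law $$(t_1,\ldots,t_n;p;q_1,\ldots,q_n)*(t_1',\ldots,t_n';p';q_1',\ldots,q_n')=\left(t_1+t_1'+\tfrac12(p'q_1-pq_1'),\ldots,t_n+t_n'+\tfrac12(p'q_n-pq_n');\ p+p';\ q_1+q_1',\ldots,q_n+q_n'\right).$$ *)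

(* Defs.v *)
From HB Require Import structures.
From mathcomp Require Import all_boot all_order all_algebra.
From mathcomp Require Import all_classical all_reals all_analysis.
From mathcomp Require Import ring.

Set Implicit Arguments.
Unset Strict Implicit.
Unset Printing Implicit Defensive.

Import Order.TTheory GRing.Theory Num.Theory.
Import numFieldNormedType.Exports.

Local Open Scope ring_scope.

Section SymmetricDifference.
Variables (T : finType).

Definition symd (A B : {set T}) : {set T} := [set i | (i \in A) (+) (i \in B)].

Lemma symdA : associative symd.
Proof. by move=> A B C; apply/setP => i; rewrite !inE addbA. Qed.

Lemma symdC : commutative symd.
Proof. by move=> A B; apply/setP => i; rewrite !inE addbC. Qed.

Lemma symd0 A : symd A finset.set0 = A.
Proof. by apply/setP => i; rewrite !inE addbF. Qed.

Lemma sym0d A : symd finset.set0 A = A.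
Proof. by rewrite symdC symd0. Qed.

Lemma symdd A : symd A A = finset.set0.
Proof. by apply/setP => i; rewrite !inE addbb. Qed.

Lemma symKd A : involutive (symd A).
Proof. by move=> B; rewrite symdA symdd sym0d. Qed.

Lemma prod_symd (R : comNzRingType) (f : T -> R) (A B : {set T}) :
  (forall i, f i * f i = 1) ->
  \prod_(i in symd A B) f i = (\prod_(i in A) f i) * \prod_(i in B) f i.
Proof.
move=> ff; rewrite big_mkcond [X in _ = X * _]big_mkcond /=.
rewrite [X in _ = _ * X]big_mkcond -big_split /=.
apply: eq_bigr => i _; rewrite !inE.
by case: (i \in A); case: (i \in B); rewrite /= ?ff ?mulr1 ?mul1r.
Qed.

End SymmetricDifference.

(* The Clifford algebra Cl(n): the real vector space with basis (e_S) indexed by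
   the subsets S of {0, ..., n-1}, where e_S stands for the product of the
   generators e_i, i in S, in increasing order (see cl_basisE), and with
   e_S * e_T = cl_sign S T *: e_(S symmetric difference T). *)
Definition clifford (R : realType) (n : nat) := {ffun {set 'I_n} -> R^o}.

HB.instance Definition _ (R : realType) n :=
  GRing.Lmodule.copy (clifford R n) {ffun {set 'I_n} -> R^o}.

Section Clifford.
Variables (R : realType) (n : nat).
Local Notation Cl := (clifford R n).
Local Notation S0 := (@finset.set0 'I_n).
Implicit Types (a b c : Cl) (S T U : {set 'I_n}).

(* One factor -1 for each transposition needed to sort e_S e_T (j < i), and one
   for each cancelled square e_i e_i = -1 (j = i). *)
Definition cl_sign S T : R :=
  \prod_(i in S) \prod_(j in T) (if (j <= i)%N then -1 else 1).

Definition cl_basis S : Cl := [ffun T => (T == S)%:R].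

Definition cl_one : Cl := cl_basis S0.

(* Given S, the only T with symd S T = U is symd S U. *)
Definition cl_mul a b : Cl :=
  [ffun U => \sum_S cl_sign S (symd S U) * (a S * b (symd S U))].

Let sgn2 (i j : 'I_n) :
  (if (j <= i)%N then -1 else 1 : R) * (if (j <= i)%N then -1 else 1) = 1.
Proof. by case: ifP; rewrite ?mulrNN mulr1. Qed.

Lemma cl_sign0l T : cl_sign S0 T = 1.
Proof. by rewrite /cl_sign big_set0. Qed.

Lemma cl_sign0r S : cl_sign S S0 = 1.
Proof. by rewrite /cl_sign big1// => i _; rewrite big_set0. Qed.

Lemma cl_signDr S T U : cl_sign S (symd T U) = cl_sign S T * cl_sign S U.
Proof.
rewrite /cl_sign -big_split; apply: eq_bigr => i _ /=.
by rewrite prod_symd// => j; exact: sgn2.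
Qed.

Lemma cl_signDl S T U : cl_sign (symd S T) U = cl_sign S U * cl_sign T U.
Proof.
rewrite /cl_sign prod_symd// => i; by rewrite -big_split; apply: big1 => j _; exact: sgn2.
Qed.

Lemma cl_mulA : associative cl_mul.
Proof.
move=> a b c; apply/ffunP => V; rewrite !ffunE.
under eq_bigr => S _ do rewrite ffunE !mulr_sumr.
under [RHS]eq_bigr => W _ do rewrite ffunE mulr_suml mulr_sumr.
rewrite [RHS]exchange_big; apply: eq_bigr => S _ /=.
rewrite [RHS](reindex_inj (can_inj (symKd S))).
apply: eq_bigr => T _ /=.
rewrite symKd -[symd (symd S T) V]symdA [symd T (symd S V)]symdA [symd T S]symdC -symdA.
have -> : symd S V = symd T (symd S (symd T V)).
  by rewrite [symd S (symd T V)]symdA [symd S T]symdC -symdA symKd.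
by rewrite cl_signDl !(cl_signDr _ T); ring.
Qed.

Lemma cl_mul1 : left_id cl_one cl_mul.
Proof.
move=> a; apply/ffunP => U; rewrite !ffunE (bigD1 S0)//= big1 => [|S nS].
  by rewrite ffunE eqxx cl_sign0l sym0d !mul1r addr0.
by rewrite ffunE (negPf nS) mul0r mulr0.
Qed.

Lemma cl_mulr1 : right_id cl_one cl_mul.
Proof.
move=> a; apply/ffunP => U; rewrite !ffunE (bigD1 U)//= big1 => [|S nS].
  by rewrite ffunE symdd eqxx cl_sign0r !mulr1 mul1r addr0.
rewrite ffunE; have /negPf-> : symd S U != S0.
  by apply: contra nS => /eqP SU; rewrite -[U](symKd S) SU symd0.
by rewrite !mulr0.
Qed.

Lemma cl_mulDl : left_distributive cl_mul +%R.
Proof.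
move=> a b c; apply/ffunP => U; rewrite !ffunE -big_split /=.
by apply: eq_bigr => S _; rewrite ffunE; ring.
Qed.

Lemma cl_mulDr : right_distributive cl_mul +%R.
Proof.
move=> a b c; apply/ffunP => U; rewrite !ffunE -big_split /=.
by apply: eq_bigr => S _; rewrite ffunE; ring.
Qed.

Lemma cl_one_neq0 : cl_one != 0.
Proof.
apply/eqP => /ffunP /(_ S0); rewrite !ffunE eqxx => /eqP.
by rewrite oner_eq0.
Qed.

HB.instance Definition _ := GRing.Zmodule_isNzRing.Build Cl
  cl_mulA cl_mul1 cl_mulr1 cl_mulDl cl_mulDr cl_one_neq0.

Lemma cl_scaleAl (k : R) a b : k *: (a * b) = k *: a * b.
Proof.
apply/ffunP => U; rewrite !ffunE [LHS]mulr_sumr.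
by apply: eq_bigr => S _; rewrite ffunE /GRing.scale /=; ring.
Qed.

HB.instance Definition _ := GRing.Lmodule_isLalgebra.Build R Cl cl_scaleAl.

Lemma cl_scaleAr (k : R) a b : k *: (a * b) = a * (k *: b).
Proof.
apply/ffunP => U; rewrite !ffunE [LHS]mulr_sumr.
by apply: eq_bigr => S _; rewrite ffunE /GRing.scale /=; ring.
Qed.

HB.instance Definition _ := GRing.Lalgebra_isAlgebra.Build R Cl cl_scaleAr.

Definition cl_gen (i : 'I_n) : Cl := cl_basis [set i].

Lemma cl_basisM S T :
  cl_basis S * cl_basis T = cl_sign S T *: cl_basis (symd S T).
Proof.
apply/ffunP => U; rewrite !ffunE (bigD1 S)//= big1 => [|S' nS].
  rewrite !ffunE eqxx mul1r addr0.
  have -> : (symd S U == T) = (U == symd S T).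
    by apply/eqP/eqP => [<-|->]; rewrite symKd.
  by rewrite /GRing.scale /=; case: eqP => [->|_]; rewrite ?symKd // !mulr0.
by rewrite ffunE (negPf nS) mul0r mulr0.
Qed.

Lemma cl_genM (i j : 'I_n) :
  cl_gen i * cl_gen j + cl_gen j * cl_gen i = (- 2 * (i == j)%:R)%:A.
Proof.
rewrite /cl_gen !cl_basisM /cl_sign !big_set1 [symd [set j] _]symdC -scalerDl.
case: (ltngtP j i) => ji.
- by rewrite addNr scale0r gt_eqF// mulr0 scale0r.
- by rewrite subrr scale0r lt_eqF// mulr0 scale0r.
- by rewrite (ord_inj ji) symdd eqxx mulr1 -opprD.
Qed.

Lemma cl_basisE (s : seq 'I_n) : sorted (fun i j : 'I_n => (i < j)%N) s ->
  cl_basis [set i in s] = \prod_(i <- s) cl_gen i.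
Proof.
elim: s => [_|i s IHs s_s].
  rewrite big_nil; congr cl_basis; by apply/setP => i; rewrite !inE.
have lt_tr : transitive (fun k l : 'I_n => (k < l)%N).
  by move=> x y z; exact: ltn_trans.
have /allP lti := order_path_min lt_tr s_s.
rewrite big_cons -IHs ?(path_sorted s_s)// cl_basisM /cl_sign big_set1 big1.
  rewrite scale1r; congr cl_basis; apply/setP => k; rewrite !inE.
  by have [->|//] := eqVneq k i; case: (boolP (i \in s)) => // /lti; rewrite ltnn.
by move=> k; rewrite inE => /lti ik; rewrite leqNgt ik.
Qed.

Lemma cl_basis_sum a : a = \sum_S a S *: cl_basis S.
Proof.
apply/ffunP => T; rewrite sum_ffunE (bigD1 T)//= big1 => [|S nS].
  by rewrite !ffunE eqxx addr0 [RHS]mulr1.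
by rewrite !ffunE eq_sym (negPf nS) [LHS]mulr0.
Qed.

(* The copy span_R {1, e_j} of the complex numbers, with coordinates
   u = (cre u)%:A + cim j u *: cl_gen j. *)
Definition in_C (j : 'I_n) (u : Cl) : Prop :=
  exists x y : R, u = x%:A + y *: cl_gen j.

Definition cre (u : Cl) : R := u S0.

Definition cim (j : 'I_n) (u : Cl) : R := u [set j].

Lemma creE j (x y : R) : cre (x%:A + y *: cl_gen j) = x.
Proof.
rewrite /cre !ffunE eqxx; have /negPf-> : S0 != [set j].
  by apply/eqP => /setP /(_ j); rewrite !inE eqxx.
by rewrite /GRing.scale /= mulr1 mulr0 addr0.
Qed.

Lemma cimE j (x y : R) : cim j (x%:A + y *: cl_gen j) = y.
Proof.
rewrite /cim !ffunE eqxx; have /negPf-> : [set j] != S0.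
  by apply/eqP => /setP /(_ j); rewrite !inE eqxx.
by rewrite /GRing.scale /= mulr1 mulr0 add0r.
Qed.

Definition cconj (j : 'I_n) (u : Cl) : Cl := (cre u)%:A - cim j u *: cl_gen j.

Definition cexp (j : 'I_n) (theta : R) : Cl :=
  (cos theta)%:A + sin theta *: cl_gen j.

(* n-tuples of Clifford numbers; C^n is its subset in_Cn. *)
Definition in_Cn (u : {ffun 'I_n -> Cl}) : Prop := forall j, in_C j (u j).

Definition cdot (u v : {ffun 'I_n -> Cl}) : Cl := \sum_j cconj j (u j) * v j.

Definition Cn_norm2 (u : {ffun 'I_n -> Cl}) : R :=
  \sum_j (cre (u j) ^+ 2 + cim j (u j) ^+ 2).

Local Notation mu := (@lebesgue_measure R).

(* Functions representing the elements of R_2(R), two such functions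
   representing the same element when they agree almost everywhere. *)
Definition R2 (f : R -> {ffun 'I_n -> Cl}) : Prop :=
  [/\ forall x, in_Cn (f x),
      forall j, measurable_fun [set: R] (fun x => cre (f x j)),
      forall j, measurable_fun [set: R] (fun x => cim j (f x j)) &
      (\int[mu]_x (Cn_norm2 (f x))%:E < +oo)%E].

Definition cl_integral (F : R -> Cl) : Cl :=
  [ffun S => \int[mu]_x (F x S : R)].

Definition inner (f f' : R -> {ffun 'I_n -> Cl}) : Cl :=
  cl_integral (fun x => cdot (f x) (f' x)).

End Clifford.

Record Ggroup (R : realType) (n : nat) :=
  GElt { tpart : 'rV[R]_n; ppart : R; qpart : 'rV[R]_n }.

Section Group.
Variables (R : realType) (n : nat).
Local Notation G := (Ggroup R n).
Implicit Types g h k : G.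

Definition G_tuple g := (tpart g, ppart g, qpart g).
Definition tuple_G (x : 'rV[R]_n * R * 'rV[R]_n) : G := GElt x.1.1 x.1.2 x.2.

Lemma G_tupleK : cancel G_tuple tuple_G. Proof. by case. Qed.

HB.instance Definition _ := Choice.copy G (can_type G_tupleK).

Definition G_mul g h : G :=
  GElt (tpart g + tpart h + 2^-1 *: (ppart h *: qpart g - ppart g *: qpart h))
       (ppart g + ppart h)
       (qpart g + qpart h).

Definition G_one : G := GElt 0 0 0.

Definition G_inv g : G := GElt (- tpart g) (- ppart g) (- qpart g).

Let G_ext g h : tpart g = tpart h -> ppart g = ppart h -> qpart g = qpart h ->
  g = h.
Proof. by case: g h => [? ? ?] [? ? ?] /= -> -> ->. Qed.

Lemma G_mulA : associative G_mul.
Proof.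
by move=> g h k; apply: G_ext => /=; rewrite ?addrA//;
  apply/rowP => i; rewrite !mxE; ring.
Qed.

Lemma G_mul1 : left_id G_one G_mul.
Proof.
by move=> g; apply: G_ext => /=; rewrite ?add0r//;
  apply/rowP => i; rewrite !mxE; ring.
Qed.

Lemma G_mulr1 : right_id G_one G_mul.
Proof.
by move=> g; apply: G_ext => /=; rewrite ?addr0//;
  apply/rowP => i; rewrite !mxE; ring.
Qed.

Lemma G_mulV : left_inverse G_one G_inv G_mul.
Proof.
by move=> g; apply: G_ext => /=; rewrite ?addNr//;
  apply/rowP => i; rewrite !mxE; ring.
Qed.

Lemma G_mulrV : right_inverse G_one G_inv G_mul.
Proof.
by move=> g; apply: G_ext => /=; rewrite ?addrN//;
  apply/rowP => i; rewrite !mxE; ring.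
Qed.

HB.instance Definition _ :=
  isGroup.Build G G_mulA G_mul1 G_mulr1 G_mulV G_mulrV.

Definition rho g (f : R -> {ffun 'I_n -> clifford R n}) :
    R -> {ffun 'I_n -> clifford R n} := fun x =>
  [ffun j => cexp j (2 * tpart g 0 j +
                     qpart g 0 j * (Num.sqrt 2 * x - ppart g))
             * f (x - Num.sqrt 2 * ppart g) j].

End Group.

(* Main.v *)
Require Import Defs.
From HB Require Import structures.
From mathcomp Require Import all_boot all_order all_algebra.
From mathcomp Require Import all_classical all_reals all_analysis.
From mathcomp Require Import measurable_realfun ring.

Set Implicit Arguments.
Unset Strict Implicit.
Unset Printing Implicit Defensive.

Import Order.TTheory GRing.Theory Num.Theory.
Import numFieldNormedType.Exports.

Local Open Scope ring_scope.

(** The operator rho_g is a translation followed by a multiplication, in each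
    component, by a unit of span{1, e_j}. This plane is commutative, so the
    phases add up in a composition and cancel in conj(u_j) * v_j; what remains
    of unitarity is the translation invariance of the Lebesgue integral,
    applied to each real coordinate of the Clifford-valued integral. *)

(** * Translation invariance of Lebesgue measure and integrals on the line *)

Section Translation.
Variables (R : realType) (c : R).
Local Open Scope classical_set_scope.
Local Notation mu := (@lebesgue_measure R).
Local Notation tr := ((fun x : R => x - c) : R -> measurableTypeR R).

Lemma measurable_translation : measurable_fun [set: R] tr.
Proof. by apply: measurable_funB. Qed.

(** By uniqueness of the Lebesgue measure, it suffices to compare the two measures on intervals []a,
    b]], where only the length counts. *)
Lemma lebesgue_measure_translation (A : set R) : measurable A ->
  pushforward mu tr A = mu A.
Proof.
have mtr : @measurable_fun _ _ (measurableTypeR R) (measurableTypeR R) setT tr.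
  exact: measurable_translation.
(* Bundling [tr] as a measurable function lets its pushforward be inferred as a measure, as
   [lebesgue_measure_unique] demands. *)
pose m := isMeasurableFun.Build _ _ _ _ _ mtr.
pose ptr : {mfun measurableTypeR R >-> measurableTypeR R} :=
  HB.pack (tr : measurableTypeR R -> measurableTypeR R) m.
move=> mA; apply/esym.
apply: (@lebesgue_measure_unique _ (pushforward mu ptr)) => //= _ [[a b]] _ <-.
rewrite /pushforward.
have -> : ptr @^-1` `]a, b] = `]a + c, b + c].
  by apply/seteqP; split => x /=; rewrite !in_itv/= ltrBrDr lerBlDr.
by rewrite !lebesgue_measure_itv/= !lte_fin ltrD2r -!EFinB opprD addrACA subrr addr0.
Qed.

Lemma ge0_integral_translation (f : R -> \bar R) :
  measurable_fun [set: R] f -> (forall x, 0 <= f x)%E ->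
  (\int[mu]_x f (x - c)%R = \int[mu]_x f x)%E.
Proof.
move=> mf f0; rewrite -[LHS](@ge0_integral_pushforward _ _
  (measurableTypeR R) (measurableTypeR R) R tr measurable_translation mu setT f)//.
apply: eq_measure_integral => [?|? A mA _].
  exact: measurable_translation.
exact: lebesgue_measure_translation.
Qed.

(** Positive and negative parts are translated separately, so the extended integrals already agree
    before [fine] is applied. *)
Lemma Rintegral_translation (f : R -> R) : measurable_fun [set: R] f ->
  \int[mu]_x f (x - c) = \int[mu]_x f x.
Proof.
move=> /measurable_EFinP mf; rewrite /Rintegral; congr fine.
rewrite integralE [RHS]integralE; congr (_ - _)%E.
- rewrite -(ge0_integral_translation (measurable_funepos mf))//.
  by apply: eq_integral => x _; rewrite !funeposE.
- rewrite -(ge0_integral_translation (measurable_funeneg mf))//.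
  by apply: eq_integral => x _; rewrite !funenegE.
Qed.

Lemma ae_translation (P : R -> Prop) :
  {ae mu, forall x, P x} -> {ae mu, forall x, P (x - c)}.
Proof.
move=> [N [mN N0 PN]]; exists (tr @^-1` N); split.
- by rewrite -[_ @^-1` _]setTI; exact: measurable_translation.
- by rewrite -N0 -[RHS]lebesgue_measure_translation.
- by move=> x /= nP; exact: PN.
Qed.

End Translation.

(** * Complex arithmetic in the plane spanned by 1 and e_j *)

Section ComplexPlane.
Variables (R : realType) (n : nat) (j : 'I_n).
Local Notation Cl := (clifford R n).
Implicit Types (u v : Cl) (x y s t : R).

Definition cpx x y : Cl := x%:A + y *: cl_gen R j.

Lemma cl_gen_sqr : cl_gen R j * cl_gen R j = (-1)%:A.
Proof.
by rewrite /cl_gen cl_basisM /cl_sign !big_set1 leqnn symdd.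
Qed.

Let clZl x u v : (x *: u) * v = x *: (u * v). Proof. by rewrite scalerAl. Qed.

Let clZr x u v : u * (x *: v) = x *: (u * v). Proof. by rewrite scalerAr. Qed.

Lemma cpxM x y s t : cpx x y * cpx s t = cpx (x * s - y * t) (x * t + y * s).
Proof.
rewrite /cpx mulrDl !mulrDr !clZl !clZr !mul1r !mulr1 cl_gen_sqr !scalerA.
rewrite mulrN1 scalerBl scalerDl scaleNr.
by rewrite [RHS]addrACA [X in _ = _ + X]addrC.
Qed.

Lemma cpxE u : in_C j u -> u = cpx (cre u) (cim j u).
Proof. by move=> [x [y ->]]; rewrite creE cimE. Qed.

Lemma in_C_cpx x y : in_C j (cpx x y). Proof. by exists x, y. Qed.

Lemma in_CM u v : in_C j u -> in_C j v -> in_C j (u * v).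
Proof. by move=> /cpxE -> /cpxE ->; rewrite cpxM; exact: in_C_cpx. Qed.

Lemma creM u v : in_C j u -> in_C j v ->
  cre (u * v) = cre u * cre v - cim j u * cim j v.
Proof. by move=> /cpxE {1}-> /cpxE {1}->; rewrite cpxM creE. Qed.

Lemma cimM u v : in_C j u -> in_C j v ->
  cim j (u * v) = cre u * cim j v + cim j u * cre v.
Proof. by move=> /cpxE {1}-> /cpxE {1}->; rewrite cpxM cimE. Qed.

Lemma in_C_cexp t : in_C j (cexp j t). Proof. exact: in_C_cpx. Qed.

Lemma cre_cexp t : cre (cexp j t) = cos t. Proof. exact: creE. Qed.

Lemma cim_cexp t : cim j (cexp j t) = sin t. Proof. exact: cimE. Qed.

Lemma cexp0 : cexp j (0 : R) = 1.
Proof. by rewrite /cexp cos0 sin0 scale0r addr0 scale1r. Qed.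

(** In the coordinates of [cpxM] these are the addition formulas for cosine and sine. *)
Lemma cexpD s t : cexp j (s + t) = cexp j s * cexp j t.
Proof. by rewrite [RHS]cpxM /cexp cosD sinD [sin s * _ + _]addrC. Qed.

Lemma cnorm2_cexpM t u : in_C j u ->
  cre (cexp j t * u) ^+ 2 + cim j (cexp j t * u) ^+ 2 =
  cre u ^+ 2 + cim j u ^+ 2.
Proof.
move=> Cu; rewrite creM ?cimM//; try exact: in_C_cexp.
rewrite cre_cexp cim_cexp.
transitivity ((cos t ^+ 2 + sin t ^+ 2) * (cre u ^+ 2 + cim j u ^+ 2)); first ring.
by rewrite cos2Dsin2 mul1r.
Qed.

Lemma cconjM_cpx u v : in_C j u -> in_C j v ->
  cconj j u * v = cpx (cre u * cre v + cim j u * cim j v)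
                      (cre u * cim j v - cim j u * cre v).
Proof.
move=> Cu Cv; rewrite {1}(cpxE Cv) /cconj -scaleNr -/(cpx _ _) cpxM.
by congr cpx; ring.
Qed.

Lemma cconj_cexpM t u v : in_C j u -> in_C j v ->
  cconj j (cexp j t * u) * (cexp j t * v) = cconj j u * v.
Proof.
move=> Cu Cv; have Ct := in_C_cexp t.
rewrite !cconjM_cpx ?creM ?cimM//; try exact: in_CM.
rewrite cre_cexp cim_cexp.
(* Inserting the factor cos^2 + sin^2 on the right turns each coordinate into a polynomial identity,
   which [ring] can close. *)
have E z : z = (cos t ^+ 2 + sin t ^+ 2) * z by rewrite cos2Dsin2 mul1r.
by congr cpx; rewrite [RHS]E; ring.
Qed.

End ComplexPlane.

(** * The operators rho_g: group law, action on R_2 and unitarity *)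

Section Representation.
Variables (R : realType) (n : nat).
Local Notation Cl := (clifford R n).
Local Notation CCn := {ffun 'I_n -> Cl}.
Implicit Types (g h : Ggroup R n) (f : R -> CCn).

Definition phase g (j : 'I_n) (x : R) : R :=
  2 * tpart g 0 j + qpart g 0 j * (Num.sqrt 2 * x - ppart g).

Lemma rhoE g f x j :
  rho g f x j = cexp j (phase g j x) * f (x - Num.sqrt 2 * ppart g) j.
Proof. by rewrite /rho ffunE. Qed.

(* Translating the phase of [h] by [sqrt 2 * p] produces [- 2 p q']; on the
   right it comes from twice the central term, [p' q - p q'], plus the cross
   terms [- q p' - q' p] of [(q + q') (sqrt 2 x - (p + p'))]. *)
Lemma phaseM g h j x :
  phase g j x + phase h j (x - Num.sqrt 2 * ppart g) = phase (g * h)%g j x.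
Proof.
have s2 : Num.sqrt 2 * Num.sqrt 2 = 2 :> R by rewrite -expr2 sqr_sqrtr.
rewrite /phase /= !mxE.
by field: s2.
Qed.

Lemma rho1 f : rho (1%g : Ggroup R n) f = f.
Proof.
apply/funext => x; apply/ffunP => j; rewrite rhoE /phase /= !mxE.
by rewrite mulr0 subr0 mulr0 mul0r addr0 cexp0 mul1r subr0.
Qed.

Lemma rhoM g h f : rho g (rho h f) = rho (g * h)%g f.
Proof.
apply/funext => x; apply/ffunP => j; rewrite !rhoE mulrA -cexpD phaseM.
by rewrite mulrDr opprD addrA.
Qed.

Lemma rho_linear g (a : R) f f' :
  rho g (fun x => a *: f x + f' x) = (fun x => a *: rho g f x + rho g f' x).
Proof.
by apply/funext => x; apply/ffunP => j; rewrite !ffunE mulrDr scalerAr.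
Qed.

(** The value of [rho g f] at x depends on f only through its value at one translated point, so the
    exceptional set lies in a translate of a null set. *)
Lemma rho_ae g f f' :
  {ae @lebesgue_measure R, forall x, f x = f' x} ->
  {ae @lebesgue_measure R, forall x, rho g f x = rho g f' x}.
Proof.
move=> /(ae_translation (Num.sqrt 2 * ppart g)).
apply: negligibleS => x /= nE E; apply: nE.
by apply/ffunP => j; rewrite !rhoE E.
Qed.

Lemma measurable_phase g j : measurable_fun [set: R] (phase g j).
Proof.
apply: measurable_funD => //; apply: measurable_funM => //.
by apply: measurable_funB => //; exact: measurable_funM.
Qed.

Lemma measurable_Cn_norm2 f : R2 f ->
  measurable_fun [set: R] (fun x => Cn_norm2 (f x)).
Proof.
move=> [_ mre mim _]; apply: measurable_sum => j.
by apply: measurable_funD; apply: measurable_funX.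
Qed.

Lemma Cn_norm2_ge0 (u : CCn) : 0 <= Cn_norm2 u.
Proof. by apply: sumr_ge0 => j _; rewrite addr_ge0 ?sqr_ge0. Qed.

Lemma R2_rho g f : R2 f -> R2 (rho g f).
Proof.
move=> R2f; have [Cf mre mim fin] := R2f.
have mc : measurable_fun [set: R] (@cos R).
  by apply: continuous_measurable_fun; exact: continuous_cos.
have ms : measurable_fun [set: R] (@sin R).
  by apply: continuous_measurable_fun; exact: continuous_sin.
have mcp j : measurable_fun [set: R] (fun x => cos (phase g j x)).
  exact: measurableT_comp mc (measurable_phase g j).
have msp j : measurable_fun [set: R] (fun x => sin (phase g j x)).
  exact: measurableT_comp ms (measurable_phase g j).
have mtr := measurable_translation (Num.sqrt 2 * ppart g).
split.
- by move=> x j; rewrite rhoE; apply: in_CM (in_C_cexp j _) (Cf _ j).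
(* The phase rotates the two real coordinates: each new one combines the translated old ones with
   coefficients cos and sin of the phase. *)
- move=> j; under eq_fun => x.
    rewrite rhoE (creM (in_C_cexp j _) (Cf _ j)) cre_cexp cim_cexp; over.
  apply: measurable_funB; apply: measurable_funM => //.
  + exact: measurableT_comp (mre j) mtr.
  + exact: measurableT_comp (mim j) mtr.
- move=> j; under eq_fun => x.
    rewrite rhoE (cimM (in_C_cexp j _) (Cf _ j)) cre_cexp cim_cexp; over.
  apply: measurable_funD; apply: measurable_funM => //.
  + exact: measurableT_comp (mim j) mtr.
  + exact: measurableT_comp (mre j) mtr.
(* Rotations preserve the pointwise norm, so the integral is that of a translate of
   [Cn_norm2 (f x)]. *)
- under eq_integral => x _.
    have -> : Cn_norm2 (rho g f x) = Cn_norm2 (f (x - Num.sqrt 2 * ppart g)).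
      by apply: eq_bigr => j _; rewrite rhoE (cnorm2_cexpM _ (Cf _ j)).
    over.
  rewrite (ge0_integral_translation _ (f := fun x => (Cn_norm2 (f x))%:E))//.
    by apply/measurable_EFinP; exact: measurable_Cn_norm2.
  by move=> x; rewrite lee_fin Cn_norm2_ge0.
Qed.

Lemma measurable_cdot f f' (S : {set 'I_n}) : R2 f -> R2 f' ->
  measurable_fun [set: R] (fun x => cdot (f x) (f' x) S).
Proof.
move=> [Cf mre mim _] [Cf' mre' mim' _].
(* For fixed [S] the coordinates of 1 and e_j are constants, which leaves a polynomial in the
   measurable real coordinates of f and f'. *)
rewrite (_ : (fun x => _) = (fun x => \sum_j
    ((cre (f x j) * cre (f' x j) + cim j (f x j) * cim j (f' x j)) *
       (1 : Cl) S +
     (cre (f x j) * cim j (f' x j) - cim j (f x j) * cre (f' x j)) *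
       cl_gen R j S))); last first.
  apply/funext => x; rewrite /cdot sum_ffunE; apply: eq_bigr => j _.
  by rewrite (cconjM_cpx (Cf x j) (Cf' x j)) /cpx ffunE; congr (_ + _); rewrite ffunE.
apply: measurable_sum => j.
by apply: measurable_funD; apply: measurable_funM => //;
  [apply: measurable_funD|apply: measurable_funB]; apply: measurable_funM.
Qed.

Lemma inner_rho g f f' : R2 f -> R2 f' ->
  inner (rho g f) (rho g f') = inner f f'.
Proof.
move=> R2f R2f'; have [Cf _ _ _] := R2f; have [Cf' _ _ _] := R2f'.
apply/ffunP => S; rewrite !ffunE.
(* Once the right side is translated, the two integrands agree pointwise by cancellation of the
   phases. *)
rewrite -[RHS](Rintegral_translation (Num.sqrt 2 * ppart g)
  (measurable_cdot S R2f R2f')).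
apply: eq_Rintegral => x _; congr (fun_of_fin _ S).
by apply: eq_bigr => j _; rewrite !rhoE (cconj_cexpM _ (Cf _ j) (Cf' _ j)).
Qed.

End Representation.

Theorem mainTheorem1 (R : realType) (n : nat) (hn : (0 < n)%N) :
  [/\ (* each rho g is a well-defined linear operator on R_2(R) *)
      [/\ forall (g : Ggroup R n) (f : R -> {ffun 'I_n -> clifford R n}),
            R2 f -> R2 (rho g f),
          forall (g : Ggroup R n) (f f' : R -> {ffun 'I_n -> clifford R n}),
            R2 f -> R2 f' ->
            {ae @lebesgue_measure R, forall x, f x = f' x} ->
            {ae @lebesgue_measure R, forall x, rho g f x = rho g f' x} &
          forall (g : Ggroup R n) (a : R)
                 (f f' : R -> {ffun 'I_n -> clifford R n}),
            R2 f -> R2 f' ->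
            rho g (fun x => a *: f x + f' x) =
            (fun x => a *: rho g f x + rho g f' x)],
      (* rho is a representation *)
      forall f : R -> {ffun 'I_n -> clifford R n},
        R2 f -> rho (1%g : Ggroup R n) f = f,
      forall (g g' : Ggroup R n) (f : R -> {ffun 'I_n -> clifford R n}),
        R2 f -> rho g (rho g' f) = rho (g * g')%g f &
      (* rho is unitary *)
      forall (g : Ggroup R n) (f f' : R -> {ffun 'I_n -> clifford R n}),
        R2 f -> R2 f' -> inner (rho g f) (rho g f') = inner f f'].
Proof.
split; last by move=> g f f'; exact: inner_rho.
- split=> [g f|g f f' _ _|g a f f' _ _].
  + exact: R2_rho.
  + exact: rho_ae.
  + exact: rho_linear.
- by move=> f _; exact: rho1.
- by move=> g h f _; exact: rhoM.
Qed.
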